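(* For every non-negative integer $N$, \[\sum_{\pi\in\mathcal{D}_{\le N}} q^{\mathcal{O}(\pi)} z^{\gamma(\pi)} = \sum_{k=0}^N q^k z^k {N\brack k}_q,\qquad \sum_{\pi\in\mathcal{P}_{\le N}} q^{\mathcal{O}(\pi)} z^{\gamma(\pi)} = \sum_{k=0}^N \frac{q^k z^k}{(q;q)_k(q;q)_{N-k}}.\]
   Context: A partition $\pi=(\lambda_1,\lambda_2,\dots)$ is a finite non-increasing sequence of positive integers; the empty sequence is the unique partition of $0$. $\mathcal{P}_{\le N}$ is the set of partitions with all parts $\le N$ and $\mathcal{D}_{\le N}$ the set of partitions into distinct parts, all $\le N$. $\mathcal{O}(\pi)=\lambda_1+\lambda_3+\cdots$ and $\gamma(\pi)=\lambda_1-\lambda_2+\lambda_3-\lambda_4+\cdots$. $(a;q)_l=\prod_{i=0}^{l-1}(1-aq^i)$, and ${n+m\brack n}_q=\frac{(q;q)_{n+m}}{(q;q)_n(q;q)_m}$ for $n,m\ge0$ and $0$ otherwise. Identities are of formal power series in $q$ with polynomial coefficients in $z$. *)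

(* Defs.v *)
From HB Require Import structures.
From mathcomp Require Import all_boot all_order all_algebra.
From mathcomp Require Import boolp classical_sets cardinality fsbigop.

Set Implicit Arguments.
Unset Strict Implicit.
Unset Printing Implicit Defensive.

Import GRing.Theory.
Local Open Scope ring_scope.

(* Formal power series. The record wrapper keeps the Cauchy product apart from
   the pointwise product on nat -> R. *)
Record fps (R : Type) := Fps { fps_coef : nat -> R }.

HB.instance Definition _ (R : Type) := [isNew for @fps_coef R].
HB.instance Definition _ (R : choiceType) := [Choice of fps R by <:].

Lemma fpsP (R : Type) (f g : fps R) : fps_coef f =1 fps_coef g <-> f = g.
Proof. by split=> [|-> //]; case: f g => [f] [g] /= /funext ->. Qed.

Section Zmodule.
Variable R : zmodType.
Implicit Types f g h : fps R.

Definition fps_zero : fps R := Fps (fun=> 0).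
Definition fps_opp f : fps R := Fps (fun n => - fps_coef f n).
Definition fps_add f g : fps R := Fps (fun n => fps_coef f n + fps_coef g n).

Fact fps_addA : associative fps_add.
Proof. by move=> f g h; apply/fpsP => n /=; rewrite addrA. Qed.
Fact fps_addC : commutative fps_add.
Proof. by move=> f g; apply/fpsP => n /=; rewrite addrC. Qed.
Fact fps_add0 : left_id fps_zero fps_add.
Proof. by move=> f; apply/fpsP => n /=; rewrite add0r. Qed.
Fact fps_addN : left_inverse fps_zero fps_opp fps_add.
Proof. by move=> f; apply/fpsP => n /=; rewrite addNr. Qed.

HB.instance Definition _ :=
  GRing.isZmodule.Build (fps R) fps_addA fps_addC fps_add0 fps_addN.
End Zmodule.

Section ComRing.
Variable R : comNzRingType.
Implicit Types f g h : fps R.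

Definition fps_C (c : R) : fps R := Fps (fun n => if n == 0%N then c else 0).
Definition fps_X : fps R := Fps (fun n => (n == 1%N)%:R).
Definition fps_mul f g : fps R :=
  Fps (fun n => \sum_(i < n.+1) fps_coef f i * fps_coef g (n - i)).

Let trunc m f : {poly R} := \poly_(i < m.+1) fps_coef f i.

Let coef_trunc m f n : (n <= m)%N -> (trunc m f)`_n = fps_coef f n.
Proof. by move=> le_nm; rewrite coef_poly ltnS le_nm. Qed.

Let trunc_mul m f g n : (n <= m)%N ->
  fps_coef (fps_mul f g) n = (trunc m f * trunc m g)`_n.
Proof.
move=> le_nm; rewrite coefM; apply: eq_bigr => -[i /= le_in] _.
by rewrite !coef_trunc // (leq_trans _ le_nm) // leq_subr.
Qed.

Fact fps_mulA : associative fps_mul.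
Proof.
move=> f g h; apply/fpsP => n.
transitivity ((trunc n f * (trunc n g * trunc n h))`_n).
  rewrite coefM; apply: eq_bigr => i _; have le_in : (i <= n)%N := ltn_ord i.
  by rewrite (@trunc_mul n) ?leq_subr // coef_trunc.
rewrite mulrA coefM; apply: eq_bigr => i _.
have le_in : (i <= n)%N := ltn_ord i.
by rewrite (@trunc_mul n) // coef_trunc // leq_subr.
Qed.

Fact fps_mulC : commutative fps_mul.
Proof.
by move=> f g; apply/fpsP => n; rewrite !(@trunc_mul n) // mulrC.
Qed.

Fact fps_mul1 : left_id (fps_C 1) fps_mul.
Proof.
move=> f; apply/fpsP => n /=.
rewrite big_ord_recl /= mul1r subn0 big1 ?addr0 // => i _.
by rewrite mul0r.
Qed.

Fact fps_mulDl : left_distributive fps_mul (@fps_add R).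
Proof.
move=> f g h; apply/fpsP => n /=; rewrite -big_split /=.
by apply: eq_bigr => i _; rewrite mulrDl.
Qed.

Fact fps_oner_neq0 : fps_C 1 != 0.
Proof. by apply/eqP => /fpsP/(_ 0%N)/eqP /=; rewrite oner_eq0. Qed.

HB.instance Definition _ := GRing.Zmodule_isComNzRing.Build (fps R)
  fps_mulA fps_mulC fps_mul1 fps_mulDl fps_oner_neq0.
End ComRing.

Section UnitRing.
Variable R : comUnitRingType.
Implicit Types f g : fps R.

Definition fps_unit : {pred fps R} := fun f => fps_coef f 0 \is a GRing.unit.

(* The first n coefficients of the inverse, from g_0 = 1 / f_0 and
   g_m = - (f_1 g_(m-1) + ... + f_m g_0) / f_0. *)
Fixpoint fps_inv_seq f n : seq R :=
  if n is m.+1 then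
    let s := fps_inv_seq f m in
    rcons s ((fps_coef f 0)^-1 *
             ((m == 0%N)%:R - \sum_(i < m) fps_coef f i.+1 * s`_(m - i.+1)))
  else [::].

Definition fps_inv f : fps R :=
  if f \in fps_unit then Fps (fun n => (fps_inv_seq f n.+1)`_n) else f.

Let size_inv_seq f n : size (fps_inv_seq f n) = n.
Proof. by elim: n => //= n IHn; rewrite size_rcons IHn. Qed.

Let nth_inv_seq f n m : (m < n)%N ->
  (fps_inv_seq f n)`_m = (fps_inv_seq f m.+1)`_m.
Proof.
elim: n => // n IHn; rewrite ltnS leq_eqVlt => /predU1P[-> // | lt_mn].
by rewrite -IHn //= nth_rcons size_inv_seq lt_mn.
Qed.

Fact fps_mulV : {in fps_unit, left_inverse 1 fps_inv *%R}.
Proof.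
move=> f Uf; rewrite mulrC /fps_inv Uf; apply/fpsP => n.
have invE : (fps_inv_seq f n.+1)`_n = (fps_coef f 0)^-1 * ((n == 0%N)%:R -
    \sum_(i < n) fps_coef f i.+1 * (fps_inv_seq f (n - i.+1).+1)`_(n - i.+1)).
  rewrite [LHS]nth_rcons size_inv_seq ltnn eqxx; congr (_ * (_ - _)).
  apply: eq_bigr => i _; rewrite nth_inv_seq //.
  by rewrite ltn_subrL /= (leq_ltn_trans _ (ltn_ord i)).
transitivity (\sum_(i < n.+1)
  fps_coef f i * (fps_inv_seq f (n - i).+1)`_(n - i)); first by [].
rewrite big_ord_recl subn0 invE mulVKr // subrK.
by rewrite [RHS]/=; case: (n == 0%N).
Qed.

Fact fps_unitPl f g : g * f = 1 -> f \in fps_unit.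
Proof.
move=> /fpsP/(_ 0%N) /=; rewrite big_ord1 => gf1.
by apply/unitrPr; exists (fps_coef g 0); rewrite mulrC.
Qed.

Fact fps_inv_out : {in [predC fps_unit], fps_inv =1 id}.
Proof. by move=> f; rewrite inE /fps_inv => /negPf ->. Qed.

HB.instance Definition _ :=
  GRing.ComNzRing_hasMulInverse.Build (fps R) fps_mulV fps_unitPl fps_inv_out.
End UnitRing.

(* Sum of a family with the coefficientwise (q-adic) convention: each power of
   the variable occurs in only finitely many terms. The finiteness clause is
   needed because \sum_(i \in A) is 0 on an infinite support. *)
Definition fps_has_sum (R : zmodType) (I : choiceType) (A : set I)
    (F : I -> fps R) (S : fps R) : Prop :=
  forall n : nat,
    finite_set [set i | A i /\ fps_coef (F i) n <> 0] /\
    fps_coef S n = \sum_(i \in A) fps_coef (F i) n.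

Definition qpoch (R : pzRingType) (a q : R) (l : nat) : R :=
  \prod_(i < l) (1 - a * q ^+ i).

Definition qbinom (R : unitRingType) (q : R) (n k : nat) : R :=
  if (k <= n)%N then qpoch q q n / (qpoch q q k * qpoch q q (n - k)) else 0.

Definition is_partition (s : seq nat) : bool :=
  sorted geq s && all (fun x => 0 < x)%N s.

Definition parts_le (N : nat) : set (seq nat) :=
  [set s | is_partition s /\ all (fun x => x <= N)%N s].

Definition distinct_parts_le (N : nat) : set (seq nat) :=
  [set s | parts_le N s /\ uniq s].

(* nth counts from 0, so lambda_1, lambda_3, ... sit at the even indices. *)
Definition odd_sum (s : seq nat) : nat :=
  (\sum_(i < size s | ~~ odd i) nth 0 s i)%N.

Definition alt_sum (s : seq nat) : int :=
  \sum_(i < size s) (-1) ^+ i * (nth 0%N s i)%:Z.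

Definition q : fps {poly int} := fps_X {poly int}.
Definition z : fps {poly int} := fps_C 'X.

(* z is not invertible, so z ^ m means a power only for m >= 0; this is enough
   because alt_sum is non-negative on partitions. *)
Lemma alt_sum_ge0 (s : seq nat) : is_partition s -> (0 <= alt_sum s)%R.
Proof.
suff H: sorted geq s -> (0 <= alt_sum s <= (head 0%N s)%:Z).
  by case/andP=> /H/andP[].
elim: s => [_|x s IHs xs]; first by rewrite /alt_sum big_ord0.
have /andP[ge0 le_h] := IHs (path_sorted xs).
have -> : alt_sum (x :: s) = x%:Z - alt_sum s.
  rewrite /alt_sum big_ord_recl /= expr0 mul1r -sumrN; congr (_ + _).
  by apply: eq_bigr => i _; rewrite exprS mulN1r mulNr.
have le_hx: (head 0%N s <= x)%N by case: s xs {IHs ge0 le_h} => //= y s /andP[].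
rewrite Num.Theory.subr_ge0 (Order.POrderTheory.le_trans le_h) ?lez_nat //=.
by rewrite Num.Theory.gerBl.
Qed.

(* Main.v *)
Require Import Defs.
From mathcomp Require Import all_boot all_order all_algebra.
From mathcomp Require Import boolp classical_sets cardinality fsbigop.
From mathcomp Require Import finmap zify ring.

(** Prepending a part [m] to [pi] turns the weight [q^O z^gamma] of [pi] into
    [(q z)^m] times its value at [z := 1 / (q z)].  For distinct parts, splitting
    on whether [N + 1] occurs gives [D_(N+1)(z) = D_N(z) + (q z)^(N+1) D_N(1/(q z))],
    which is the q-Pascal rule for the right-hand side.  For unrestricted parts,
    removing two copies of [N + 1] divides the weight by [q^(N+1)], whence
    [(1 - q^(N+1)) P_(N+1)(z) = P_N(z) + (q z)^(N+1) P_N(1/(q z))], so that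
    [P_N = D_N / (q; q)_N].  As [z] is not invertible, the substitution is replaced
    by a second weight, summed simultaneously with the first. *)

Set Implicit Arguments.
Unset Strict Implicit.
Unset Printing Implicit Defensive.

Import Order.TTheory GRing.Theory Num.Theory.
Local Open Scope classical_set_scope.
Local Open Scope ring_scope.

(** * Sums of families of power series *)

Definition fps_summable (R : zmodType) (I : choiceType) (A : set I)
    (F : I -> fps R) : Prop :=
  forall n, finite_set [set i | A i /\ fps_coef (F i) n <> 0].

Section HasSum.
Variables (R : zmodType) (I : choiceType).
Implicit Types (A B : set I) (F G : I -> fps R) (S T : fps R).

Lemma fps_has_sum_summable A F S : fps_has_sum A F S -> fps_summable A F.
Proof. by move=> hS n; have [] := hS n. Qed.

Lemma fps_summable_has_sum A F : fps_summable A F ->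
  fps_has_sum A F (Fps (fun n => \sum_(i \in A) fps_coef (F i) n)).
Proof. by move=> sF n; split. Qed.

Lemma fps_has_sum_unique A F S T :
  fps_has_sum A F S -> fps_has_sum A F T -> S = T.
Proof. by move=> hS hT; apply/fpsP => n; rewrite (hS n).2 (hT n).2. Qed.

Lemma eq_fps_has_sum A F G S : (forall i, A i -> F i = G i) ->
  fps_has_sum A F S -> fps_has_sum A G S.
Proof.
move=> FG hS n; have [fin ->] := hS n; split.
  by apply: sub_finite_set fin => i /= [Ai]; rewrite FG.
by apply: eq_fsbigr => i /set_mem Ai; rewrite FG.
Qed.

Lemma fps_has_sum_set1 i F : fps_has_sum [set i] F (F i).
Proof.
move=> n; split; last by rewrite fsbig_set1.
by apply: sub_finite_set (finite_set1 i) => j [].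
Qed.

(** One list serves all coefficients up to [n] at once, because the [n]-th coefficient of a Cauchy
    product involves every lower one. *)
Lemma fps_summable_support A F n : fps_summable A F ->
  exists r : seq I, [/\ uniq r, [set` r] `<=` A &
    forall i m, A i -> i \notin r -> (m <= n)%N -> fps_coef (F i) m = 0].
Proof.
move=> sF.
pose B := \bigcup_(m in `I_n.+1) [set i | A i /\ fps_coef (F i) m <> 0].
have finB : finite_set B by apply: bigcup_finite.
exists (fset_set B); split=> [|i|i m Ai]; first exact: fset_uniq.
  by rewrite /= in_fset_set // => /set_mem[m _ []].
rewrite in_fset_set // => /negP nBi le_mn; apply: contrapT => Fi0.
by apply: nBi; apply/mem_set; exists m.
Qed.

Lemma fsumr_seq_support A (f : I -> R) (r : seq I) : uniq r -> [set` r] `<=` A ->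
  (forall i, A i -> i \notin r -> f i = 0) ->
  \sum_(i \in A) f i = \sum_(i <- r) f i.
Proof.
move=> Ur rA r0; rewrite (fsbigE r) // big_seq_cond [RHS]big_seq_cond.
apply: eq_bigl => i; rewrite andbT.
by case ir: (i \in r) => //=; rewrite mem_set //; apply: rA.
Qed.

(** The list depends on [n] and need only contain the support, so lists found for different families
    can be concatenated. *)
Lemma fps_has_sumI A F S :
  (forall n, exists r : seq I, [/\ uniq r, [set` r] `<=` A,
    forall i, A i -> i \notin r -> fps_coef (F i) n = 0 &
    fps_coef S n = \sum_(i <- r) fps_coef (F i) n]) -> fps_has_sum A F S.
Proof.
move=> h n; have [r [Ur rA r0 ->]] := h n; split.
  apply: sub_finite_set (finite_seq r) => i /= [Ai Fi0].
  by apply: contrapT => /negP /(r0 _ Ai).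
by rewrite (fsumr_seq_support Ur).
Qed.

Lemma fps_has_sum_coef A F S n r : fps_has_sum A F S ->
  uniq r -> [set` r] `<=` A ->
  (forall i, A i -> i \notin r -> fps_coef (F i) n = 0) ->
  fps_coef S n = \sum_(i <- r) fps_coef (F i) n.
Proof.
by move=> hS Ur rA r0; rewrite (hS n).2 (fsumr_seq_support Ur).
Qed.

Lemma fps_has_sumU A B F S T : A `&` B `<=` set0 ->
  fps_has_sum A F S -> fps_has_sum B F T -> fps_has_sum (A `|` B) F (S + T).
Proof.
move=> AB hS hT; apply: fps_has_sumI => n.
have [r [Ur rA r0]] := fps_summable_support n (fps_has_sum_summable hS).
have [s [Us sB s0]] := fps_summable_support n (fps_has_sum_summable hT).
exists (r ++ s); split.
- rewrite cat_uniq Ur Us andbT /=; apply/hasPn => i si; apply/negP => ri.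
  by apply: (AB i); split; [apply: rA | apply: sB].
- by move=> i /=; rewrite mem_cat => /orP[/rA|/sB]; [left | right].
- by move=> i ABi; rewrite mem_cat negb_or => /andP[ri si];
     case: ABi => Ci; [apply: r0 | apply: s0].
- rewrite big_cat /=; congr (_ + _).
    by apply: (fps_has_sum_coef hS) => // i Ai ir; apply: r0.
  by apply: (fps_has_sum_coef hT) => // i Bi ir; apply: s0.
Qed.

Lemma fps_has_sum_image (J : choiceType) (h : J -> I) (D : set J) F S :
  injective h -> fps_has_sum D (F \o h) S -> fps_has_sum (h @` D) F S.
Proof.
move=> inj_h hS n; have [fin ->] := hS n; split.
  apply: sub_finite_set (finite_image h fin) => _ [[j Dj <-] Fj0].
  by exists j.
by rewrite fsbig_image // => i j _ _ /inj_h.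
Qed.
End HasSum.

Lemma fps_has_sumM (R : comNzRingType) (I : choiceType) (A : set I)
    (F : I -> fps R) (c S : fps R) :
  fps_has_sum A F S -> fps_has_sum A (fun i => c * F i) (c * S).
Proof.
move=> hS; apply: fps_has_sumI => n.
have [r [Ur rA r0]] := fps_summable_support n (fps_has_sum_summable hS).
exists r; split=> // [i Ai ir /=|/=].
  by apply: big1 => j _; rewrite r0 ?mulr0 // leq_subr.
rewrite exchange_big; apply: eq_bigr => j _ /=; rewrite -mulr_sumr; congr (_ * _).
by apply: (fps_has_sum_coef hS) => // i Ai ir; rewrite r0 ?leq_subr.
Qed.

(** * Gaussian binomials *)

Section QBinomial.
Variables (R : comUnitRingType) (x : R).
Hypothesis unit_x : forall k, 1 - x ^+ k.+1 \is a GRing.unit.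

Lemma qpochS n : qpoch x x n.+1 = qpoch x x n * (1 - x ^+ n.+1).
Proof. by rewrite /qpoch big_ord_recr /= -exprS. Qed.

Lemma unit_qpoch n : qpoch x x n \is a GRing.unit.
Proof.
elim: n => [|n IHn]; first by rewrite /qpoch big_ord0 unitr1.
by rewrite qpochS unitrM IHn unit_x.
Qed.

Lemma qbinom0 n : qbinom x n 0 = 1.
Proof.
by rewrite /qbinom subn0 [qpoch x x 0]big_ord0 mul1r divrr // unit_qpoch.
Qed.

Lemma qbinom_small n k : (n < k)%N -> qbinom x n k = 0.
Proof. by rewrite /qbinom ltnNge => /negPf->. Qed.

Lemma qbinom_sub n k : (k <= n)%N -> qbinom x n (n - k) = qbinom x n k.
Proof.
move=> le_kn; rewrite /qbinom leq_subr le_kn subKn //.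
by rewrite [qpoch x x (n - k) * _]mulrC.
Qed.

Lemma divr_unitMr (a b u : R) : u \is a GRing.unit -> b \is a GRing.unit ->
  a * u / (b * u) = a / b.
Proof. by move=> Uu Ub; rewrite invrM // mulrA mulrK. Qed.

(** Over the common denominator [d], the rule becomes [(1 - x^(n-k)) + x^(n-k) (1 - x^(k+1)) = 1 -
    x^(n+1)]. *)
Lemma qbinomS n k : (k <= n)%N ->
  qbinom x n.+1 k.+1 = qbinom x n k.+1 + x ^+ (n - k) * qbinom x n k.
Proof.
move=> le_kn; pose d := qpoch x x k.+1 * qpoch x x (n - k).
have -> : qbinom x n k.+1 = qpoch x x n * (1 - x ^+ (n - k)) / d.
  (* For [k = n] the left side is 0 by convention, matching the factor [1 - x^0]. *)
  case: (ltnP k n) => [lt_kn | le_nk]; last first.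
    have nk0 : (n - k = 0)%N by lia.
    by rewrite qbinom_small // nk0 expr0 subrr mulr0 mul0r.
  rewrite /qbinom lt_kn /d -[(n - k)%N]subnSK //.
  rewrite [qpoch x x (n - k.+1).+1]qpochS mulrA divr_unitMr //.
  by rewrite unitrM !unit_qpoch.
have -> : qbinom x n k = qpoch x x n * (1 - x ^+ k.+1) / d.
  rewrite /qbinom le_kn /d qpochS [qpoch x x k * _ * _]mulrAC divr_unitMr //.
  by rewrite unitrM !unit_qpoch.
rewrite /qbinom ltnS le_kn subSS mulrA -mulrDl; congr (_ / _); rewrite qpochS.
have -> : n.+1 = (n - k + k.+1)%N by lia.
by rewrite exprD; ring.
Qed.

(** The q-Pascal rule summed against an arbitrary [f]; the second sum is reversed by [k -> n - k],
    using the symmetry of Gaussian binomials. Two choices of [f] give the two recurrences below. *)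
Lemma sum_qbinomS n (f : nat -> R) :
  \sum_(k < n.+2) f k * qbinom x n.+1 k =
  \sum_(k < n.+1) f k * qbinom x n k +
  \sum_(k < n.+1) f (n.+1 - k)%N * x ^+ k * qbinom x n k.
Proof.
rewrite big_ord_recl qbinom0 mulr1.
under eq_bigr => k _ do rewrite lift0 qbinomS ?leq_ord // mulrDr.
rewrite big_split /= addrA; congr (_ + _).
  rewrite big_ord_recr /= qbinom_small // mulr0 addr0.
  by rewrite [RHS]big_ord_recl qbinom0 mulr1.
rewrite (reindex_inj rev_ord_inj); apply: eq_bigr => k _ /=.
have le_kn := leq_ord k.
by rewrite subSS qbinom_sub // subKn // -subSn // mulrA.
Qed.
End QBinomial.

(** * The two sums of Gaussian binomials and their recurrences *)

Section QSums.
Variables (R : comUnitRingType) (x t : R).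
Hypothesis unit_x : forall k, 1 - x ^+ k.+1 \is a GRing.unit.

Definition qbinom_sum n : R := \sum_(k < n.+1) x ^+ k * t ^+ k * qbinom x n k.

(* The polynomial [qbinom_sum n] at [t := 1 / (x t)], times [t ^+ m]. *)
Definition qbinom_cosum n m : R := \sum_(k < n.+1) t ^+ (m - k) * qbinom x n k.

Lemma qbinom_sumS n :
  qbinom_sum n.+1 = qbinom_sum n + x ^+ n.+1 * qbinom_cosum n n.+1.
Proof.
rewrite /qbinom_sum (sum_qbinomS unit_x n (fun k => x ^+ k * t ^+ k)).
congr (_ + _); rewrite mulr_sumr; apply: eq_bigr => k _.
have -> : x ^+ n.+1 = x ^+ (n.+1 - k) * x ^+ k by rewrite -exprD subnK // ltnW.
by ring.
Qed.

Lemma qbinom_cosumS n m : (n < m)%N ->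
  qbinom_cosum n.+1 m = qbinom_cosum n m + t ^+ (m - n.+1) * qbinom_sum n.
Proof.
move=> lt_nm.
rewrite /qbinom_cosum (sum_qbinomS unit_x n (fun k => t ^+ (m - k))).
congr (_ + _); rewrite mulr_sumr; apply: eq_bigr => k _.
(* Here [n < m] prevents truncation of the subtraction. *)
have -> : (m - (n.+1 - k) = m - n.+1 + k)%N by have := ltn_ord k; lia.
by rewrite exprD; ring.
Qed.
End QSums.

(** * Partitions and their weights *)

Definition even_sum (s : seq nat) : nat :=
  (\sum_(i < size s | odd i) nth 0 s i)%N.

Lemma odd_sum_cons x s : odd_sum (x :: s) = (x + even_sum s)%N.
Proof.
rewrite /odd_sum /even_sum /= big_mkcond big_ord_recl /=; congr (_ + _)%N.
by rewrite [RHS]big_mkcond; apply: eq_bigr => i _; rewrite negbK.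
Qed.

Lemma even_sum_cons x s : even_sum (x :: s) = odd_sum s.
Proof.
rewrite /odd_sum /even_sum /= big_mkcond big_ord_recl /= add0n.
by rewrite [RHS]big_mkcond; apply: eq_bigr => i _.
Qed.

Lemma alt_sum_cons x s : alt_sum (x :: s) = x%:Z - alt_sum s.
Proof.
rewrite /alt_sum big_ord_recl /= expr0 mul1r -sumrN; congr (_ + _).
by apply: eq_bigr => i _; rewrite exprS mulN1r mulNr.
Qed.

(** Either exponent of [q] thus bounds the number of parts, which gives summability once the parts
    are bounded. The two bounds are proved together because prepending a part swaps the two sums. *)
Lemma size_le_odd_even_sum s : all (fun x => 0 < x)%N s ->
  (size s <= (odd_sum s).*2)%N && (size s <= (even_sum s).*2.+1)%N.
Proof.
elim: s => [|x s IHs] //=.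
by case/andP=> x0 /IHs; rewrite odd_sum_cons even_sum_cons; lia.
Qed.

Lemma is_partition_cons x s : is_partition (x :: s) =
  [&& (0 < x)%N, all (fun y => y <= x)%N s & is_partition s].
Proof.
rewrite /is_partition /= path_sortedE; last by move=> a b c /= ab ca; lia.
by case: (0 < x)%N; rewrite ?andbF //= andbA.
Qed.

Lemma parts_leW N s : parts_le N s -> parts_le N.+1 s.
Proof. by case=> ps sN; split=> //; apply: sub_all sN => x /= /leqW. Qed.

Lemma parts_le0 : parts_le 0 = [set [::]].
Proof.
apply/seteqP; split=> [[|x s] // [] |_ ->]; last by split.
by rewrite is_partition_cons /= => /andP[x0 _] /andP[]; lia.
Qed.

Lemma parts_le_cons N s : parts_le N.+1 (N.+1 :: s) <-> parts_le N.+1 s.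
Proof.
rewrite /parts_le /= is_partition_cons /= leqnn /=.
by split=> [[/andP[_ ->]] //|[-> ->]].
Qed.

Lemma parts_leSP N s : parts_le N.+1 s ->
  parts_le N s \/ exists2 t, s = N.+1 :: t & parts_le N.+1 t.
Proof.
case: s => [|x s]; first by left.
case: (ltngtP x N.+1) => [lt_xN|gt_xN|->] [ps sN].
- left; split=> //; move: ps; rewrite is_partition_cons => /and3P[_ sx _] /=.
  by rewrite -ltnS lt_xN; apply: sub_all sx => y /=; lia.
- by case/andP: sN; lia.
- by right; exists s => //; apply/parts_le_cons; split.
Qed.

Lemma not_parts_le_cons N s : ~ parts_le N (N.+1 :: s).
Proof. by case=> _ /=; rewrite ltnn. Qed.

(** A natural exponent, so that the power laws apply to the non-invertible [z]. *)
Definition alt_nat (s : seq nat) : nat := `|alt_sum s|%N.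

Lemma alt_natE s : is_partition s -> alt_sum s = (alt_nat s)%:Z.
Proof. by move=> /alt_sum_ge0/gez0_abs. Qed.

(** The bound is the non-negativity of the alternating sum of [N :: s]. *)
Lemma alt_nat_cons N s : parts_le N s ->
  (alt_nat s <= N)%N /\ alt_nat (N :: s) = (N - alt_nat s)%N.
Proof.
(* [0 :: s] is not a partition, so [N = 0] is treated apart; there [s] is empty. *)
case: N => [|N] ps; first by have:= ps; rewrite parts_le0 => ->;
  rewrite /alt_nat alt_sum_cons /alt_sum big_ord0.
have := alt_sum_ge0 ((parts_le_cons N s).2 ps).1.
rewrite /alt_nat alt_sum_cons (alt_natE ps.1) absz_nat => h; split; lia.
Qed.

Lemma finite_parts_le_size N m :
  finite_set [set s | parts_le N s /\ (size s <= m)%N].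
Proof.
suff fin : finite_set [set s | all (fun x => x <= N)%N s /\ (size s <= m)%N].
  by apply: sub_finite_set fin => s [[_ sN] sm].
elim: m => [|m IHm].
  apply: sub_finite_set (finite_set1 [::]) => s [_ /=].
  by rewrite leqn0 size_eq0 => /eqP.
pose D := [set [::]] `|`
  \bigcup_(x in `I_N.+1) cons x @`
    [set s | all (fun x => x <= N)%N s /\ (size s <= m)%N].
apply: (@sub_finite_set _ _ D) => [[|x s] /= []|].
- by left.
- by case/andP=> xN sN sm; right; exists x => //; exists s.
- rewrite finite_setU; split=> //.
  by apply: bigcup_finite => // x _; apply: finite_image.
Qed.

Definition wt (s : seq nat) : fps {poly int} := q ^+ odd_sum s * z ^+ alt_nat s.

(* Prepending a part [m] exchanges [wt] and [cowt m], up to powers of [q] and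
   [z]; the subtraction is only meaningful for [alt_nat s <= m]. *)
Definition cowt (m : nat) (s : seq nat) : fps {poly int} :=
  q ^+ even_sum s * z ^+ (m - alt_nat s).

Lemma wt_cons N s : parts_le N.+1 s -> wt (N.+1 :: s) = q ^+ N.+1 * cowt N.+1 s.
Proof.
move=> /alt_nat_cons[_ aE].
by rewrite /wt /cowt odd_sum_cons aE exprD mulrA.
Qed.

Lemma cowt_cons N m s : (N < m)%N -> parts_le N.+1 s ->
  cowt m (N.+1 :: s) = z ^+ (m - N.+1) * wt s.
Proof.
move=> lt_Nm /alt_nat_cons[le_aN aE].
rewrite /wt /cowt even_sum_cons aE mulrCA -exprD; congr (_ * z ^+ _); lia.
Qed.

(** Two equal leading parts cancel in the alternating sum, and exactly one of them counts in
    [odd_sum]. *)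
Lemma wt_cons2 N s : parts_le N.+1 s ->
  wt (N.+1 :: N.+1 :: s) = q ^+ N.+1 * wt s.
Proof.
move=> ps; rewrite wt_cons; last exact/parts_le_cons.
by rewrite cowt_cons // subnn expr0 mul1r.
Qed.

Lemma cowt_cons2 N m s : (N < m)%N -> parts_le N.+1 s ->
  cowt m (N.+1 :: N.+1 :: s) = q ^+ N.+1 * cowt m s.
Proof.
move=> lt_Nm ps; rewrite cowt_cons //; last exact/parts_le_cons.
rewrite wt_cons // mulrCA; congr (_ * _).
rewrite /cowt mulrCA -exprD; congr (_ * z ^+ _).
have [] := alt_nat_cons ps; lia.
Qed.

(** * Coefficients of monomials and summability of the weights *)

Lemma fps_coef_mulX (R : comNzRingType) (f : fps R) n :
  fps_coef (fps_X R * f) n = if n is n'.+1 then fps_coef f n' else 0.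
Proof.
case: n => [|n] /=; first by rewrite big_ord1 mul0r.
rewrite big_ord_recl mul0r add0r big_ord_recl /= mul1r subSS subn0.
by rewrite big1 ?addr0 // => i _; rewrite mul0r.
Qed.

Lemma fps_coef_qX a (f : fps {poly int}) n :
  fps_coef (q ^+ a * f) n = if (a <= n)%N then fps_coef f (n - a) else 0.
Proof.
elim: a n => [|a IHa] n; first by rewrite expr0 mul1r subn0.
by rewrite exprS -mulrA fps_coef_mulX; case: n => [|n] //; rewrite IHa.
Qed.

Lemma fps_coef_zX b n : fps_coef (z ^+ b) n = if n == 0%N then 'X^b else 0.
Proof.
elim: b n => [|b IHb] n; first by rewrite expr0.
rewrite exprS /= big_ord_recl /= subn0 IHb big1 ?addr0;
  last by move=> i _; rewrite mul0r.
by case: eqP; rewrite ?mulr0 // -exprS.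
Qed.

Lemma fps_coef_qXzX a b n : fps_coef (q ^+ a * z ^+ b) n <> 0 -> n = a.
Proof.
rewrite fps_coef_qX fps_coef_zX; case: ifP => // le_an.
case: eqP => // /eqP; rewrite subn_eq0 => le_na _.
by apply/eqP; rewrite eqn_leq le_na.
Qed.

Lemma summable_wt N : fps_summable (parts_le N) wt.
Proof.
move=> n; apply: sub_finite_set (finite_parts_le_size N n.*2) => s [ps].
move=> /fps_coef_qXzX ->; split=> //; case: ps => /andP[_ s0] _.
by have /andP[] := size_le_odd_even_sum s0.
Qed.

Lemma summable_cowt N m : fps_summable (parts_le N) (cowt m).
Proof.
move=> n; apply: sub_finite_set (finite_parts_le_size N n.*2.+1) => s [ps].
move=> /fps_coef_qXzX ->; split=> //; case: ps => /andP[_ s0] _.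
by have /andP[] := size_le_odd_even_sum s0.
Qed.

Lemma unit_1subqX k : 1 - q ^+ k.+1 \is a GRing.unit.
Proof.
have q0 : fps_coef (q ^+ k.+1) 0 = 0 by rewrite -[q ^+ _]mulr1 fps_coef_qX.
suff : 1 - fps_coef (q ^+ k.+1) 0 \is a GRing.unit by [].
by rewrite q0 subr0 unitr1.
Qed.

(** * The recurrences *)

Section Adjoin.
Variables (N : nat) (A : set (seq nat)).
Hypothesis AN : A `<=` parts_le N.

(** Allows one part [N.+1] on top of [A]: this is the whole step for distinct parts, and the case of
    multiplicity at most one for unrestricted parts. *)
Definition adjoin : set (seq nat) := A `|` cons N.+1 @` A.

Lemma adjoin_disjoint : A `&` cons N.+1 @` A `<=` set0.
Proof.
by move=> t [At [s _ sE]]; move: At; rewrite -sE => /AN/not_parts_le_cons.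
Qed.

Lemma has_sum_wt_adjoin S T :
  fps_has_sum A wt S -> fps_has_sum A (cowt N.+1) T ->
  fps_has_sum adjoin wt (S + q ^+ N.+1 * T).
Proof.
move=> hS hT; apply: fps_has_sumU adjoin_disjoint hS _.
apply: fps_has_sum_image => [s t [] //|].
apply: eq_fps_has_sum (fps_has_sumM _ hT) => s As /=.
by rewrite wt_cons //; apply/parts_leW/AN.
Qed.

Lemma has_sum_cowt_adjoin m S T : (N < m)%N ->
  fps_has_sum A wt S -> fps_has_sum A (cowt m) T ->
  fps_has_sum adjoin (cowt m) (T + z ^+ (m - N.+1) * S).
Proof.
move=> lt_Nm hS hT; apply: fps_has_sumU adjoin_disjoint hT _.
apply: fps_has_sum_image => [s t [] //|].
apply: eq_fps_has_sum (fps_has_sumM _ hS) => s As /=.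
by rewrite cowt_cons //; apply/parts_leW/AN.
Qed.
End Adjoin.

Lemma distinct_parts_le0 : distinct_parts_le 0 = [set [::]].
Proof.
by rewrite /distinct_parts_le parts_le0; apply/seteqP; split=> s [] // ->.
Qed.

Lemma distinct_parts_leS N :
  distinct_parts_le N.+1 = adjoin N (distinct_parts_le N).
Proof.
apply/seteqP; split=> s.
  case=> ps Us; case: (parts_leSP ps) => [|[t sE pt]]; first by left.
  move: Us; rewrite sE => /= /andP[tN Ut]; right; exists t => //; split=> //.
  case: (parts_leSP pt) => // -[t' tE _].
  by move: tN; rewrite tE mem_head.
case=> [[ps Us]|[t [pt Ut] <-]]; first by split=> //; apply: parts_leW.
split; first exact/parts_le_cons/parts_leW.
rewrite /= Ut andbT; apply/negP => /(allP pt.2) /=; lia.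
Qed.

Lemma parts_leS N : parts_le N.+1 =
  adjoin N (parts_le N) `|` (fun s => N.+1 :: N.+1 :: s) @` parts_le N.+1.
Proof.
apply/seteqP; split=> s.
  move=> /parts_leSP[ps|[t -> /parts_leSP[pt|[u -> pu]]]].
  - by left; left.
  - by left; right; exists t.
  - by right; exists u.
case=> [[/parts_leW //|[t /parts_leW pt <-]]|[t pt <-]].
  exact/parts_le_cons.
by apply/parts_le_cons/parts_le_cons.
Qed.

(* If [S] is the sum over [parts_le N.+1] and [B] the sum over the partitions in
   which [N.+1] occurs at most once, then [S = B + q ^+ N.+1 * S]. *)
Lemma has_sum_parts_leS N (w : seq nat -> fps {poly int}) B :
  fps_summable (parts_le N.+1) w ->
  (forall s, parts_le N.+1 s -> w (N.+1 :: N.+1 :: s) = q ^+ N.+1 * w s) ->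
  fps_has_sum (adjoin N (parts_le N)) w B ->
  fps_has_sum (parts_le N.+1) w (B / (1 - q ^+ N.+1)).
Proof.
move=> /fps_summable_has_sum; set S := Fps _ => hS wE hB.
suff -> : B / (1 - q ^+ N.+1) = S by [].
(* Summability has already provided the series [S], so this linear equation can be solved for it,
   [1 - q ^+ N.+1] being a unit. *)
suff SE : S = B + q ^+ N.+1 * S.
  apply: (canLR (mulrK (unit_1subqX N))).
  by rewrite mulrBr mulr1 {1}SE [S * _]mulrC addrK.
apply: (fps_has_sum_unique hS); rewrite [parts_le N.+1]parts_leS.
apply: fps_has_sumU hB _.
  move=> s [adj [t _ sE]]; move: adj; rewrite -sE => -[|[u pu [uE]]].
    exact: not_parts_le_cons.
  by move: pu; rewrite uE; apply: not_parts_le_cons.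
apply: fps_has_sum_image => [s t [] //|].
by apply: eq_fps_has_sum (fps_has_sumM _ hS) => s ps; rewrite /= wE.
Qed.

(** * Evaluation of the sums by induction on [N] *)

Lemma wt_nil : wt [::] = 1.
Proof. by rewrite /wt /alt_nat /odd_sum /alt_sum !big_ord0 mulr1. Qed.

Lemma cowt_nil m : cowt m [::] = z ^+ m.
Proof. by rewrite /cowt /alt_nat /even_sum /alt_sum !big_ord0 subn0 mul1r. Qed.

Lemma qbinom_sum0 : qbinom_sum q z 0 = wt [::].
Proof.
by rewrite wt_nil /qbinom_sum big_ord1 (qbinom0 unit_1subqX) !mulr1.
Qed.

Lemma qbinom_cosum0 m : qbinom_cosum q z 0 m = cowt m [::].
Proof.
by rewrite cowt_nil /qbinom_cosum big_ord1 (qbinom0 unit_1subqX) subn0 mulr1.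
Qed.

(** Each recurrence calls on the other weight, hence the joint induction. The step for [wt] needs
    [cowt] at [N.+1] and the step for [cowt m] keeps [m], so [m] ranges over all values at least
    [N]. *)
Lemma has_sum_distinct N :
  fps_has_sum (distinct_parts_le N) wt (qbinom_sum q z N) /\
  forall m, (N <= m)%N ->
    fps_has_sum (distinct_parts_le N) (cowt m) (qbinom_cosum q z N m).
Proof.
elim: N => [|N [IHw IHc]].
  rewrite distinct_parts_le0 qbinom_sum0; split=> [|m _]; rewrite ?qbinom_cosum0;
  exact: fps_has_sum_set1.
have sub : distinct_parts_le N `<=` parts_le N by move=> s [].
rewrite distinct_parts_leS (qbinom_sumS _ unit_1subqX); split=> [|m lt_Nm].
  exact: (has_sum_wt_adjoin sub IHw (IHc _ (leqnSn N))).
rewrite (qbinom_cosumS _ unit_1subqX) //.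
exact: (has_sum_cowt_adjoin sub lt_Nm IHw (IHc _ (ltnW lt_Nm))).
Qed.

(** The same induction as for distinct parts; repetitions of [N.+1] contribute the extra factor
    [1 / (1 - q^(N+1))] at each step, and these build up [1 / (q; q)_N]. *)
Lemma has_sum_parts N :
  fps_has_sum (parts_le N) wt (qbinom_sum q z N / qpoch q q N) /\
  forall m, (N <= m)%N ->
    fps_has_sum (parts_le N) (cowt m) (qbinom_cosum q z N m / qpoch q q N).
Proof.
elim: N => [|N [IHw IHc]].
  rewrite parts_le0 qbinom_sum0 [qpoch _ _ _]big_ord0 divr1.
  split=> [|m _]; rewrite ?qbinom_cosum0 ?divr1; exact: fps_has_sum_set1.
have divE a : a / qpoch q q N.+1 = a / qpoch q q N / (1 - q ^+ N.+1).
  rewrite qpochS [qpoch q q N * _]mulrC.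
  by rewrite invrM ?unit_1subqX ?(unit_qpoch unit_1subqX) // mulrA.
split=> [|m lt_Nm]; rewrite divE.
  apply: has_sum_parts_leS => [|s ps|]; first exact: summable_wt.
    exact: wt_cons2.
  rewrite (qbinom_sumS _ unit_1subqX) mulrDl -mulrA.
  exact: (has_sum_wt_adjoin (@subset_refl _ _) IHw (IHc _ (leqnSn N))).
apply: has_sum_parts_leS => [|s ps|]; first exact: summable_cowt.
  exact: cowt_cons2.
rewrite (qbinom_cosumS _ unit_1subqX) // mulrDl -mulrA.
exact: (has_sum_cowt_adjoin (@subset_refl _ _) lt_Nm
   IHw (IHc _ (ltnW lt_Nm))).
Qed.

Theorem theorem2p5 (N : nat) :
  fps_has_sum (distinct_parts_le N)
    (fun pi => q ^+ odd_sum pi * z ^ alt_sum pi)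
    (\sum_(0 <= k < N.+1) q ^+ k * z ^+ k * qbinom q N k)
  /\
  fps_has_sum (parts_le N)
    (fun pi => q ^+ odd_sum pi * z ^ alt_sum pi)
    (\sum_(0 <= k < N.+1)
       q ^+ k * z ^+ k / (qpoch q q k * qpoch q q (N - k))).
Proof.
have wtE s : is_partition s -> wt s = q ^+ odd_sum s * z ^ alt_sum s.
  by move=> ps; rewrite (alt_natE ps).
rewrite !big_mkord; split.
  by apply: eq_fps_has_sum (has_sum_distinct N).1 => s [[ps _] _]; apply: wtE.
rewrite (_ : \sum_(_ < _) _ = qbinom_sum q z N / qpoch q q N).
  by apply: eq_fps_has_sum (has_sum_parts N).1 => s [ps _]; apply: wtE.
(* Division by [(q; q)_N] cancels the numerator of the Gaussian binomial. *)
rewrite mulr_suml; apply: eq_bigr => k _; rewrite /qbinom leq_ord.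
by rewrite [qpoch q q N / _]mulrC mulrA mulrK ?(unit_qpoch unit_1subqX).
Qed.
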